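(* Let $\Phi$ be an $M\times N$ unit norm frame with $M<\frac{N-1}{4\log4N}$. Then there exists a frame $\Psi$ that is flipping equivalent to $\Phi$ and satisfies $\nu\le\frac{\mu}{\sqrt M}$, where $\mu$ and $\nu$ are the worst-case and average coherence of $\Psi$.
   Context: $\log$ is the natural logarithm and $\log4N=\log(4N)$. A unit norm frame is an $M\times N$ real or complex matrix $\Phi=[\varphi_1\cdots\varphi_N]$ of rank $M$ with unit-norm columns. The worst-case coherence is $\mu:=\max_{i\ne j}|\langle\varphi_i,\varphi_j\rangle|$ and the average coherence is $\nu:=\max_i\left|\frac1{N-1}\sum_{j\ne i}\langle\varphi_i,\varphi_j\rangle\right|$. Frames $\Phi$ and $\Psi$ are flipping equivalent if $\Psi=\Phi D$ for some diagonal matrix $D$ with diagonal entries in $\{+1,-1\}$. *)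

(* Defs.v *)
From mathcomp Require Import all_boot all_order all_algebra.
From mathcomp Require Import complex.
From mathcomp Require Import reals exp.

Set Implicit Arguments.
Unset Strict Implicit.
Unset Printing Implicit Defensive.

Import Order.TTheory GRing.Theory Num.Theory.

Local Open Scope ring_scope.

Inductive scalar_kind := RealScalars | ComplexScalars.

Definition scalar_field (R : realType) (k : scalar_kind) : fieldType :=
  match k with RealScalars => R | ComplexScalars => R[i] end.

Definition sconj (R : realType) (k : scalar_kind) :
    scalar_field R k -> scalar_field R k :=
  match k with
  | RealScalars => fun x : R => x
  | ComplexScalars => fun z : R[i] => conjc z
  end.

(* The modulus takes its values in R, also for complex scalars: the norm
   `|z| of R[i] lives in R[i], and normc z is its real representative. *)
Definition smod (R : realType) (k : scalar_kind) : scalar_field R k -> R :=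
  match k with
  | RealScalars => fun x : R => `|x|
  | ComplexScalars => fun z : R[i] => ComplexField.Normc.normc z
  end.

Section Frames.
Variables (R : realType) (k : scalar_kind) (M N : nat).
Implicit Types (x y : 'cV[scalar_field R k]_M).
Implicit Types (Phi Psi : 'M[scalar_field R k]_(M, N)).

(* Linear in the first argument; with the opposite convention every inner
   product is conjugated, which changes neither coherence below. *)
Definition inner x y : scalar_field R k := \sum_(l < M) x l 0 * sconj (y l 0).

Definition l2norm x : R := Num.sqrt (\sum_(l < M) smod (x l 0) ^+ 2).

Definition unit_norm_frame Phi : Prop :=
  \rank Phi = M /\ forall i : 'I_N, l2norm (col i Phi) = 1.

(* The values compared are nonnegative, so the base point 0 of the two maxima
   is only visible when there is nothing to compare. *)
Definition worst_case_coherence Phi : R :=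
  \big[Num.max/0]_(i < N) \big[Num.max/0]_(j < N | j != i)
    smod (inner (col i Phi) (col j Phi)).

Definition average_coherence Phi : R :=
  \big[Num.max/0]_(i < N)
    smod ((N%:R - 1)^-1 * \sum_(j < N | j != i) inner (col i Phi) (col j Phi)).

Definition flipping_equivalent Phi Psi : Prop :=
  exists d : 'rV[scalar_field R k]_N,
    (forall i, d 0 i = 1 \/ d 0 i = -1) /\ Psi = Phi *m diag_mx d.

End Frames.

(* Main.v *)
Require Import Defs.
From mathcomp Require Import all_boot all_order all_algebra.
From mathcomp Require Import reals exp.
From mathcomp Require Import complex classical_sets topology.
From mathcomp Require Import normedtype sequences ring lra.

(** Change the sign of each column by an independent fair coin. The Gram matrix
    entry [<phi_i, phi_j>] is then multiplied by the product of two signs, so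
    the worst-case coherence [mu] does not change, while the sum over
    [j != i] that defines the average coherence becomes, up to a global sign,
    a Rademacher sum with coefficients of modulus at most [mu]. Such a sum is
    typically of order [mu * sqrt (N - 1)], and the assumption on [M] makes the
    target [(N - 1) * mu / sqrt M] exceed this by a factor
    [2 * sqrt (ln (4 * N))], enough for a union bound over all columns.

    Probability is replaced by counting over the [2 ^ N] sign patterns. The
    exponential moment of a Rademacher sum factors into hyperbolic cosines,
    each bounded by a Gaussian ([cosh_le_gauss], [rademacher_mgf]); the union
    bound [rademacher_union_bound] then produces one pattern that makes finitely
    many real sums small simultaneously. Here it is applied to [2 * N] sums,
    the real and the imaginary parts for the [N] columns, each of which has to
    be at most [(N - 1) * mu / sqrt (2 * M)]. Each sum contributes two tails,
    whence the [4 * N] inside the logarithm. *)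

Import Order.TTheory GRing.Theory Num.Theory.
Import numFieldNormedType.Exports.

Local Open Scope ring_scope.

(** * Rademacher sums *)

Lemma expn2_fact_le_fact_double (n : nat) : (2 ^ n * n`! <= n.*2`!)%N.
Proof.
elim: n => // n IH; rewrite doubleS !factS expnS mulnACA [leqRHS]mulnA.
by apply: leq_mul => //; rewrite mul2n doubleS leq_pmulr.
Qed.

(** The odd terms of the two exponential series cancel; the term of degree
    [2 * n] of cosh is [x ^ (2 * n) / (2 * n)!], against
    [x ^ (2 * n) / (2 ^ n * n!)] for the Gaussian. *)
Lemma cosh_le_gauss {R : realType} (x : R) :
  expR x + expR (- x) <= 2 * expR (x ^+ 2 / 2).
Proof.
pose A n := series (exp_coeff x) n.*2 + series (exp_coeff (- x)) n.*2.
have double_cvg : (double n @[n --> \oo] --> \oo)%classic.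
  apply/cvgnyPge => B; near=> n; apply: (@leq_trans n).
    by near: n; exact: nbhs_infty_ge.
  by rewrite -addnn leq_addr.
have A_cvg : (A n @[n --> \oo] --> expR x + expR (- x))%classic.
  by apply: cvgD; apply: (cvg_comp _ _ double_cvg);
    exact: is_cvg_series_exp_coeff.
have x2_ge0 : 0 <= x ^+ 2 / 2 by rewrite divr_ge0 ?sqr_ge0.
have A_le n : A n <= 2 * series (exp_coeff (x ^+ 2 / 2)) n.
  rewrite /A /series /=; elim: n => [|n IH].
    by rewrite !big_geq // mulr0 addr0.
  rewrite doubleS !big_nat_recr //= mulrDr.
  have even_pow : (- x) ^+ n.*2 = x ^+ n.*2.
    by rewrite exprNn -signr_odd odd_double expr0 mul1r.
  have odd_pow : (- x) ^+ n.*2.+1 = - x ^+ n.*2.+1.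
    by rewrite !exprS even_pow mulNr.
  rewrite /exp_coeff /= even_pow odd_pow mulNr.
  have le_term : x ^+ n.*2 / n.*2`!%:R <= (x ^+ 2 / 2) ^+ n / n`!%:R.
    rewrite expr_div_n -exprM mul2n -mulrA -invfM ler_wpM2l //.
      by rewrite -muln2 exprM sqr_ge0.
    rewrite lef_pV2 ?posrE ?mulr_gt0 ?exprn_gt0 ?ltr0n ?fact_gt0 //.
    by rewrite -natrX -natrM ler_nat expn2_fact_le_fact_double.
  move: IH le_term; rewrite /exp_coeff /=; lra.
apply: (ler_cvg_to A_cvg (@cvgMl_tmp _ _ _ _ _ 2 _
  (is_cvg_series_exp_coeff (x ^+ 2 / 2)))).
by apply: nearW.
Unshelve. all: by end_near. Qed.

Section Rademacher.
Context {R : realType} {J : finType}.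

(** The average of a product over independent signs is the product of the
    averages: the sum over sign patterns factors into one factor
    [expR (v j) + expR (- v j)] for each [j]. *)
Lemma rademacher_mgf (v : J -> R) :
  \sum_(s : {ffun J -> bool}) expR (\sum_j (-1) ^+ s j * v j) <=
  2 ^+ #|J| * expR ((\sum_j v j ^+ 2) / 2).
Proof.
under eq_bigr do rewrite expR_sum.
rewrite -(bigA_distr_bigA (fun j (b : bool) => expR ((-1) ^+ b * v j))) /=.
rewrite mulr_suml expR_sum -prodr_const -big_split /=.
apply: ler_prod => j _; rewrite big_bool /= expr1 expr0 mulN1r mul1r addrC.
by rewrite addr_ge0 ?expR_ge0 // cosh_le_gauss.
Qed.

(** If every sign pattern violated one of the bounds, the exponential moments
    of all sums and of their opposites, taken at [lam = tau / V], would add up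
    to more than [2 ^ #|J| * expR (tau ^ 2 / V)]. By [rademacher_mgf] they add
    up to at most [2 * #|K| * 2 ^ #|J| * expR (tau ^ 2 / (2 * V))], which by the
    hypothesis on [tau] is no larger. When [V = 0] there is no such [lam], but
    then all the sums vanish. *)
Lemma rademacher_union_bound (K : finType) (v : K -> J -> R) (V tau : R) :
  0 <= tau ->
  (forall k, \sum_j v k j ^+ 2 <= V) ->
  2 * V * ln (2 * #|K|%:R) <= tau ^+ 2 ->
  exists s : {ffun J -> bool}, forall k, `|\sum_j (-1) ^+ s j * v k j| <= tau.
Proof.
move=> tau_ge0 vV le_tau.
pose X (s : {ffun J -> bool}) k := \sum_j (-1) ^+ s j * v k j.
suff /existsP[s /forallP ?] :
    [exists s : {ffun J -> bool}, forall k, `|X s k| <= tau] by exists s.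
apply: contraT; rewrite negb_exists => /forallP bad.
have {}bad s : exists k, tau < `|X s k|.
  by have /forallPn[k] := bad s; rewrite -ltNge; exists k.
have [k0 X0] := bad [ffun=> false].
have K_gt0 : (0 < #|K|)%N by apply/card_gt0P; exists k0.
have V_ge0 : 0 <= V.
  by apply: le_trans (vV k0); apply: sumr_ge0 => j _; exact: sqr_ge0.
have [V0|V_neq0] := eqVneq V 0.
  move: X0; rewrite ltNge => /negP[]; rewrite /X big1 ?normr0 // => j _.
  have : \sum_j v k0 j ^+ 2 == 0.
    rewrite eq_le; apply/andP; split; first by have := vV k0; rewrite V0.
    by apply: sumr_ge0 => i _; exact: sqr_ge0.
  rewrite psumr_eq0 => [/allP/(_ j)|i _]; last exact: sqr_ge0.
  by rewrite mem_index_enum sqrf_eq0 => /(_ isT)/eqP ->; rewrite mulr0.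
have V_gt0 : 0 < V by rewrite lt0r V_neq0.
have card_gt0 : 0 < 2 * #|K|%:R :> R by rewrite mulr_gt0 ?ltr0n.
have ln_gt0 : 0 < ln (2 * #|K|%:R : R).
  by rewrite ln_gt0 // -natrM ltr1n (leq_trans _ (leq_pmulr 2 K_gt0)).
have tau_gt0 : 0 < tau.
  rewrite lt0r tau_ge0 andbT -sqrf_eq0 gt_eqF //.
  by apply: lt_le_trans le_tau; rewrite !mulr_gt0.
pose lam := tau / V; have lam_gt0 : 0 < lam by rewrite divr_gt0.
pose E := expR (tau ^+ 2 / (2 * V)).
have card_le : 2 * #|K|%:R <= E.
  rewrite -[leLHS]lnK ?posrE // ler_expR ler_pdivlMr ?mulr_gt0 //.
  by rewrite mulrC.
have lamtau : expR (lam * tau) = E * E.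
  by rewrite -expRD; congr expR; rewrite /lam; field.
pose S s := \sum_k (expR (lam * X s k) + expR (- lam * X s k)).
have lower : 2 ^+ #|J| * (E * E) < \sum_(s : {ffun J -> bool}) S s.
  have -> : 2 ^+ #|J| * (E * E) = \sum_(s : {ffun J -> bool}) E * E.
    by rewrite sumr_const card_ffun card_bool -natrX mulr_natl.
  apply: ltr_sum => [|s _].
    by apply/hasP; exists [ffun=> false]; rewrite ?mem_index_enum.
  have [k Xk] := bad s; rewrite -lamtau /S (bigD1 k) //=.
  rewrite ltr_wpDr ?sumr_ge0 // => [j _|]; first by rewrite addr_ge0 ?expR_ge0.
  have e1 := expR_ge0 (lam * X s k); have e2 := expR_ge0 (- lam * X s k).
  move: Xk; rewrite ltr_normr => /orP[] Xk.
    apply: (@lt_le_trans _ _ (expR (lam * X s k))); last by lra.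
    by rewrite ltr_expR ltr_pM2l.
  apply: (@lt_le_trans _ _ (expR (- lam * X s k))); last by lra.
  by rewrite ltr_expR mulNr -mulrN ltr_pM2l.
have upper : \sum_(s : {ffun J -> bool}) S s <= 2 ^+ #|J| * (2 * #|K|%:R * E).
  have mgf (c : R) k : c ^+ 2 = lam ^+ 2 ->
      \sum_(s : {ffun J -> bool}) expR (c * X s k) <= 2 ^+ #|J| * E.
    move=> c2.
    have cX s : c * X s k = \sum_j (-1) ^+ s j * (c * v k j).
      by rewrite mulr_sumr; apply: eq_bigr => j _; rewrite mulrCA.
    under eq_bigr do rewrite cX.
    apply: le_trans (rademacher_mgf _) _.
    rewrite ler_pM2l ?exprn_gt0 // ler_expR.
    under eq_bigr do rewrite exprMn c2.
    rewrite -mulr_sumr ler_pdivrMr //.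
    apply: (@le_trans _ _ (lam ^+ 2 * V)); first by rewrite ler_wpM2l ?sqr_ge0.
    by rewrite le_eqVlt; apply/orP; left; apply/eqP; rewrite /lam; field.
  rewrite exchange_big /=.
  have -> : 2 ^+ #|J| * (2 * #|K|%:R * E) =
      \sum_(k in K) (2 ^+ #|J| * E + 2 ^+ #|J| * E).
    by rewrite sumr_const -[_ *+ _]mulr_natl; ring.
  by apply: ler_sum => k _; rewrite big_split lerD //= mgf // sqrrN.
have := lt_le_trans lower upper.
by rewrite ltr_pM2l ?exprn_gt0 // ltr_pM2r ?expR_gt0 // ltNge card_le.
Qed.

End Rademacher.

(** * Scalars and sign changes *)

Section Scalars.
Context {R : realType} {k : scalar_kind}.
Implicit Types z w : scalar_field R k.

(** Both scalar kinds are treated alike through these real and imaginary parts;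
    real scalars have imaginary part zero. *)
Definition sRe : scalar_field R k -> R :=
  match k return scalar_field R k -> R with
  | RealScalars => fun x : R => x
  | ComplexScalars => @complex.Re R
  end.

Definition sIm : scalar_field R k -> R :=
  match k return scalar_field R k -> R with
  | RealScalars => fun=> 0
  | ComplexScalars => @complex.Im R
  end.

Lemma sReD : {morph sRe : z w / z + w}.
Proof. by rewrite /sRe; case: k => // -[a b] [c d]. Qed.

Lemma sImD : {morph sIm : z w / z + w}.
Proof. by rewrite /sIm; case: k => [a b|[a b] [c d]] //=; rewrite addr0. Qed.

Lemma sRe0 : sRe 0 = 0. Proof. by rewrite /sRe; case: k. Qed.

Lemma sIm0 : sIm 0 = 0. Proof. by rewrite /sIm; case: k. Qed.

Lemma sRe_sign (b : bool) z : sRe ((-1) ^+ b * z) = (-1) ^+ b * sRe z.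
Proof.
case: b; rewrite ?expr1 ?expr0 ?mul1r // !mulN1r.
by move: z; rewrite /sRe; case: k => // -[].
Qed.

Lemma sIm_sign (b : bool) z : sIm ((-1) ^+ b * z) = (-1) ^+ b * sIm z.
Proof.
case: b; rewrite ?expr1 ?expr0 ?mul1r // !mulN1r.
by move: z; rewrite /sIm; case: k => [a|[]] //=; rewrite oppr0.
Qed.

Lemma sconj_sign (b : bool) z : sconj ((-1) ^+ b * z) = (-1) ^+ b * sconj z.
Proof.
case: b; rewrite ?expr1 ?expr0 ?mul1r // !mulN1r.
by move: z; rewrite /sconj; case: k => // -[].
Qed.

Lemma smodE z : smod z = Num.sqrt (sRe z ^+ 2 + sIm z ^+ 2).
Proof.
move: z; rewrite /smod /sRe /sIm; case: k => [x|[a b]] //=.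
by rewrite expr0n addr0 sqrtr_sqr.
Qed.

Lemma smod_ge0 z : 0 <= smod z.
Proof. by rewrite smodE sqrtr_ge0. Qed.

Lemma smod_sqr z : smod z ^+ 2 = sRe z ^+ 2 + sIm z ^+ 2.
Proof. by rewrite smodE sqr_sqrtr // addr_ge0 ?sqr_ge0. Qed.

Lemma smod_sign (b : bool) z : smod ((-1) ^+ b * z) = smod z.
Proof.
by rewrite !smodE sRe_sign sIm_sign !exprMn !sqrr_sign !mul1r.
Qed.

Lemma smod_natV (n : nat) z : smod (n%:R^-1 * z) = n%:R^-1 * smod z.
Proof.
move: z; rewrite /smod; case: k => [x|z] /=.
  by rewrite normrM normfV normr_nat.
rewrite ComplexField.Normc.normcM ComplexField.Normc.normcV normcMn.
by rewrite ComplexField.Normc.normc1.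
Qed.

End Scalars.

Section Flips.
Context {R : realType} {k : scalar_kind} {M N : nat}.
Implicit Types (Phi : 'M[scalar_field R k]_(M, N)) (s : {ffun 'I_N -> bool}).

Definition flip Phi s : 'M[scalar_field R k]_(M, N) :=
  Phi *m diag_mx (\row_j (-1) ^+ s j).

Lemma flipE Phi s l j : flip Phi s l j = (-1) ^+ s j * Phi l j.
Proof. by rewrite /flip mul_mx_diag !mxE mulrC. Qed.

Lemma flip_equivalent Phi s : flipping_equivalent Phi (flip Phi s).
Proof.
exists (\row_j (-1) ^+ s j); split=> // i; rewrite mxE.
by case: (s i); [right|left]; rewrite ?expr1 ?expr0.
Qed.

Lemma flipK s : cancel (flip^~ s) (flip^~ s).
Proof.
move=> Phi; apply/matrixP => l j.
by rewrite !flipE mulrA -expr2 sqrr_sign mul1r.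
Qed.

(** Since a flip is its own inverse, each of the two matrices is a multiple of
    the other. *)
Lemma mxrank_flip Phi s : \rank (flip Phi s) = \rank Phi.
Proof.
apply/eqP; rewrite eqn_leq mxrankM_maxl /=.
by rewrite -{1}(flipK s Phi) mxrankM_maxl.
Qed.

Lemma unit_norm_frame_flip Phi s :
  unit_norm_frame Phi -> unit_norm_frame (flip Phi s).
Proof.
case=> rk nrm; split=> [|i]; first by rewrite mxrank_flip.
rewrite -(nrm i) /l2norm; congr Num.sqrt; apply: eq_bigr => l _.
by rewrite mxE [in RHS]mxE flipE smod_sign.
Qed.

Lemma inner_flip Phi s i j :
  inner (col i (flip Phi s)) (col j (flip Phi s)) =
  (-1) ^+ s i * ((-1) ^+ s j * inner (col i Phi) (col j Phi)).
Proof.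
rewrite /inner !mulr_sumr; apply: eq_bigr => l _.
have colE Psi c : col c Psi l 0 = Psi l c by rewrite mxE.
by rewrite !colE !flipE sconj_sign; ring.
Qed.

Lemma worst_case_coherence_flip Phi s :
  worst_case_coherence (flip Phi s) = worst_case_coherence Phi.
Proof.
apply: eq_bigr => i _; apply: eq_bigr => j _.
by rewrite inner_flip !smod_sign.
Qed.

Lemma worst_case_coherence_ge0 Phi : 0 <= worst_case_coherence Phi.
Proof. exact: bigmax_ge_id. Qed.

Lemma smod_inner_le Phi i j : j != i ->
  smod (inner (col i Phi) (col j Phi)) <= worst_case_coherence Phi.
Proof.
move=> ji; apply: le_trans (le_bigmax _ _ i).
exact: (le_bigmax_cond _ (fun j => smod (inner (col i Phi) (col j Phi)))).
Qed.

End Flips.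

(** * Existence of a good flip *)

Theorem theorem69 (R : realType) (k : scalar_kind) (M N : nat)
    (Phi : 'M[scalar_field R k]_(M, N)) :
  unit_norm_frame Phi ->
  (M%:R : R) < (N%:R - 1) / (4 * ln (4 * N%:R)) ->
  exists Psi : 'M[scalar_field R k]_(M, N),
    [/\ unit_norm_frame Psi,
        flipping_equivalent Phi Psi
      & average_coherence Psi <= worst_case_coherence Psi / Num.sqrt M%:R].
Proof.
move=> frame ltM.
(* For [N <= 1] the right-hand side of the bound on [M] is zero. *)
have N_gt1 : (1 < N)%N.
  move: ltM; rewrite ltNge; case: N {Phi frame} => [|[|//]] /negP[].
    by rewrite mulr0 (@ln0 _ 0) // mulr0 invr0 mulr0 ler0n.
  by rewrite subrr mul0r ler0n.
pose n := N.-1; have NE : N = n.+1 by rewrite /n prednK // ltnW.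
have n_gt0 : 0 < n%:R :> R by rewrite ltr0n -ltnS -NE.
have pred_natr (F : pzRingType) : N%:R - 1 = n%:R :> F.
  by rewrite NE -natr1 addrK.
(* An empty column has norm 0, not 1. *)
have M_gt0 : 0 < M%:R :> R.
  rewrite ltr0n lt0n; apply/negP => /eqP M0.
  have [_ /(_ (Ordinal N_gt1))] := frame.
  rewrite /l2norm big1 ?sqrtr0 => [/eqP|l]; first by rewrite eq_sym oner_eq0.
  by have := ltn_ord l; rewrite [X in (_ < X)%N]M0.
set L := ln (4 * N%:R) in ltM.
have L_gt0 : 0 < L.
  by rewrite ln_gt0 // -natrM ltr1n (leq_trans N_gt1) ?leq_pmull.
have le4ML : 4 * M%:R * L <= n%:R.
  move: ltM; rewrite pred_natr ltr_pdivlMr ?mulr_gt0 // => /ltW.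
  by rewrite mulrCA mulrA.
set mu := worst_case_coherence Phi.
have mu_ge0 : 0 <= mu := worst_case_coherence_ge0 Phi.
(* The real sums are indexed by pairs: a column, and whether the real ([true])
   or the imaginary part of its Gram row is taken. The diagonal entry is
   replaced by zero, so that all sums range over the same index set. *)
pose g i j := inner (col i Phi) (col j Phi).
pose part (b : bool) := if b then @sRe R k else @sIm R k.
pose v (p : 'I_N * bool) j := if j != p.1 then part p.2 (g p.1 j) else 0.
(* Real and imaginary part both at most [tau] give modulus at most
   [n * mu / sqrt M]: this is where the factor 2 under the root is from. *)
pose tau := n%:R * mu / Num.sqrt (2 * M%:R).
have tau2 : tau ^+ 2 = (n%:R * mu) ^+ 2 / (2 * M%:R).
  by rewrite expr_div_n sqr_sqrtr // mulr_ge0 // ltW.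
have tau_ge0 : 0 <= tau by rewrite divr_ge0 ?sqrtr_ge0 ?mulr_ge0.
have vV p : \sum_j v p j ^+ 2 <= n%:R * mu ^+ 2.
  have -> : n%:R * mu ^+ 2 = \sum_(j | j != p.1) mu ^+ 2.
    by rewrite sumr_const cardC1 card_ord mulr_natl.
  rewrite big_mkcond [leRHS]big_mkcond; apply: ler_sum => j _; rewrite /v.
  case: ifP => // [ji|_]; last by rewrite expr0n.
  have : smod (g p.1 j) ^+ 2 <= mu ^+ 2.
    by rewrite ler_sqr ?nnegrE ?smod_ge0 // smod_inner_le.
  apply: le_trans; rewrite smod_sqr /part.
  by case: p.2; rewrite ?lerDl ?lerDr sqr_ge0.
have [s small] : exists s : {ffun 'I_N -> bool},
    forall p, `|\sum_j (-1) ^+ s j * v p j| <= tau.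
  apply: (@rademacher_union_bound _ _ _ v _ tau tau_ge0 vV).
  have -> : 2 * #|{: 'I_N * bool}|%:R = 4 * N%:R :> R.
    by rewrite card_prod card_ord card_bool natrM; ring.
  rewrite -/L tau2.
  rewrite ler_pdivlMr ?mulr_gt0 //.
  have -> : 2 * (n%:R * mu ^+ 2) * L * (2 * M%:R) =
      n%:R * mu ^+ 2 * (4 * M%:R * L) by ring.
  have -> : (n%:R * mu) ^+ 2 = n%:R * mu ^+ 2 * n%:R by ring.
  by rewrite ler_wpM2l // mulr_ge0 ?sqr_ge0.
exists (flip Phi s); split.
- exact: unit_norm_frame_flip.
- exact: flip_equivalent.
rewrite worst_case_coherence_flip -/mu.
apply: bigmax_le => [|i _]; first by rewrite divr_ge0 ?sqrtr_ge0.
rewrite pred_natr smod_natV ler_pdivrMl //.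
under eq_bigr do rewrite inner_flip.
(* The sign of column [i] is common to all terms and drops out, which leaves a
   Rademacher sum. *)
rewrite -mulr_sumr smod_sign -(@ler_pXn2r _ 2) ?nnegrE ?smod_ge0 //; last first.
  by rewrite mulr_ge0 ?divr_ge0 ?sqrtr_ge0.
have partE b : part b (\sum_(j | j != i) (-1) ^+ s j * g i j) =
    \sum_j (-1) ^+ s j * v (i, b) j.
  rewrite (@big_morph _ _ (part b) 0 +%R 0 +%R); first last.
  - by case: b; [exact: sRe0|exact: sIm0].
  - by case: b; [exact: sReD|exact: sImD].
  rewrite big_mkcond; apply: eq_bigr => j _; rewrite /v /=.
  case: ifP => _; last by rewrite mulr0.
  by rewrite /part; case: b; rewrite ?sRe_sign ?sIm_sign.
have sq_le b : part b (\sum_(j | j != i) (-1) ^+ s j * g i j) ^+ 2 <= tau ^+ 2.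
  by rewrite partE -real_normK ?num_real // ler_sqr ?nnegrE ?normr_ge0.
have := lerD (sq_le true) (sq_le false); rewrite -smod_sqr tau2.
congr (_ <= _); rewrite mulrA expr_div_n sqr_sqrtr ?(ltW M_gt0) //.
by field; rewrite gt_eqF.
Qed.
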